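(* Let $X$ be a nonpositively curved $\mathcal{VH}$-complex in which each vertical edge is adjacent to finitely many squares. Then its simplexification $X^*$ is locally $6$-large.
   Context: Square complexes: a (generalised) square complex is obtained from a set of vertices, edges and squares by gluing along affine embeddings of cells onto faces of cells (closed under composition), with precisely one attaching map onto each proper face of each cell; cells need not be embedded (e.g. an edge may be a loop, or two sides of a square may be glued together). The link at a vertex $v$ is the graph with one vertex for each end of an edge at $v$ and one edge for each corner of a square at $v$, joining the two edge-ends forming that corner. A $\mathcal{VH}$-complex is a square complex whose edges are partitioned into two classes, vertical and horizontal, such that going around the boundary of each square the sides alternate between vertical and horizontal. A square complex is nonpositively curved if the link at every vertex contains no embedded combinatorial cycle of length less than $4$ (for a $\mathcal{VH}$-complex: no double edges in vertex links). Simplicial complexes: a generalised simplicial complex (called ''simplicial complex'' here) is a set of affine simplices together with a set, closed under composition, of affine embeddings (attaching maps) of simplices onto faces of simplices, such that for each proper face of each simplex there is precisely one attaching map onto it; the geometric realisation is the quotient (simplices need not be embedded). The link of a simplex $\sigma$ has one simplex for each attaching map of $\sigma$ onto a proper face of a simplex $\tau$, namely the face of $\tau$ spanned by the vertices not in the image of $\sigma$, with the restricted attaching maps. A simplicial complex is simple if it has no edge joining a vertex to itself and no two distinct simplices of positive dimension with the same boundary. A simple complex is flag if every finite clique of its $1$-skeleton spans a simplex. A cycle without diagonals is an embedded simplicial loop such that no edge of the complex connects two nonconsecutive vertices of it. A simplicial complex is locally $6$-large if all its vertex links are (simple and) flag and contain no cycles of length $4$ or $5$ without diagonals. Simplexification: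 let $X$ be a $\mathcal{VH}$-complex with vertex set $V$, set of vertical edges $E_V$ and set of squares $S$. Divide each vertical edge $e\in E_V$ in two by a new vertex $e^*$; the boundary of each square $s$ then becomes a hexagon, and $s$ is subdivided into six triangles by coning this hexagon from a new vertex $s^*$ in its interior. This gives a generalised simplicial complex $\hat X$ triangulating $X$, with vertices $v^*$ ($v\in V$), $e^*$ ($e\in E_V$), $s^*$ ($s\in S$). For $e\in E_V$ with endpoints $v_+,v_-$ (possibly equal), let $s_1,\dots,s_n$ be the squares adjacent to $e$, counted with multiplicity (a square both of whose vertical sides are $e$ is listed twice). The complex $X^*$ is obtained from $\hat X$ by attaching, for each $e\in E_V$, two simplices $\sigma^+=v_+^*e^*s_1^*\cdots s_n^*$ and $\sigma^-=v_-^*e^*s_1^*\cdots s_n^*$. They are glued to each other along their common face $e^*s_1^*\cdots s_n^*$, and for each $i$ their faces $v_\pm^*e^*s_i^*$ are glued to the corresponding two triangles of $\hat X$ containing $e^*$ inside the (occurrence of the) square $s_i$; no further identifications are made except those forced by these. Thus the link of $e^*$ in $\hat X$ is the suspension of $n$ points, whereas in $X^*$ it is the suspension of an $(n-1)$-simplex, and the union of the simplices of $X^*$ containing $e^*$ is the suspension of an $n$-simplex with some pairs of vertices possibly identified. *)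

(* Defs.v *)
From mathcomp Require Import all_boot finmap.
From mathcomp Require Import boolp.

Set Implicit Arguments.
Unset Strict Implicit.
Unset Printing Implicit Defensive.

Local Open Scope fset_scope.

(** * Generalised simplicial complexes *)

(* An affine embedding of a simplex onto a face of another one is determined by
   the injective map it induces on vertices, so a simplex [t] is represented by
   its finite nonempty vertex set [vtx t].  Attaching maps go onto proper faces
   (the identity of a simplex is not counted as an attaching map). *)
Record scomplex := SComplex {
  simplex :> Type;
  vtx : simplex -> finType;
  attach : forall s t : simplex, {ffun vtx s -> vtx t} -> Prop;
  vtx_gt0 : forall t, 0 < #|vtx t|;
  attach_inj : forall s t (f : {ffun vtx s -> vtx t}), attach f -> injective f;
  attach_proper : forall s t (f : {ffun vtx s -> vtx t}),
    attach f -> f @: [set: vtx s] != [set: vtx t];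
  attach_comp : forall r s t (f : {ffun vtx r -> vtx s})
    (g : {ffun vtx s -> vtx t}),
    attach f -> attach g -> attach [ffun x => g (f x)];
  attach_face : forall t (A : {set vtx t}), A != finset.set0 -> A != [set: vtx t] ->
    exists! p : {s : simplex & {ffun vtx s -> vtx t}},
      attach (projT2 p) /\ projT2 p @: [set: vtx (projT1 p)] = A
}.
Arguments vtx {_} _.
Arguments attach {_ _ _} _.

Lemma existT_inj (T : Type) (P : T -> Type) (x : T) (a b : P x) :
  existT P x a = existT P x b -> a = b.
Proof.
move=> E; have := projT2_eq E.
by rewrite (Prop_irrelevance (projT1_eq E) erefl).
Qed.

Lemma attach_uniq (K : scomplex) (r s t : K) (f : {ffun vtx r -> vtx t})
    (g : {ffun vtx s -> vtx t}) :
  attach f -> attach g -> f @: [set: vtx r] = g @: [set: vtx s] ->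
  existT (fun s => {ffun vtx s -> vtx t}) r f = existT _ s g.
Proof.
move=> hf hg E.
have B0 : f @: [set: vtx r] != finset.set0.
  have /card_gt0P[x _] := vtx_gt0 r.
  by apply/set0Pn; exists (f x); rewrite imset_f ?finset.in_setT.
have [p [_ up]] := attach_face B0 (attach_proper hf).
have <- := up (existT _ r f) (conj hf erefl).
by have <- := up (existT _ s g) (conj hg (esym E)).
Qed.

Section Link.
Variables (K : scomplex) (s : K).

Definition lk_simplex : Type :=
  {t : K & {f : {ffun vtx s -> vtx t} | attach f}}.

Definition lk_base (u : lk_simplex) : {ffun vtx s -> vtx (projT1 u)} :=
  sval (projT2 u).

Definition lk_vtx (u : lk_simplex) : finType :=
  {y : vtx (projT1 u) | y \notin lk_base u @: [set: vtx s]}.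

(* [g] is the restriction of an attaching map [h] of [K] that is compatible with
   the attaching maps of [s]. *)
Definition lk_attach (u w : lk_simplex) (g : {ffun lk_vtx u -> lk_vtx w}) : Prop :=
  exists h : {ffun vtx (projT1 u) -> vtx (projT1 w)},
    [/\ attach h, forall x, h (lk_base u x) = lk_base w x
      & forall y, val (g y) = h (val y)].

Lemma lk_vtx_gt0 u : 0 < #|lk_vtx u|.
Proof.
have := attach_proper (svalP (projT2 u)); rewrite -finset.subTset.
case/subsetPn=> y _ yN; apply/card_gt0P.
by exists (exist _ y yN : lk_vtx u).
Qed.

Lemma lk_attach_inj u w (g : {ffun lk_vtx u -> lk_vtx w}) :
  lk_attach g -> injective g.
Proof.
case=> h [hh _ gE] x y /(congr1 val); rewrite !gE => /(attach_inj hh).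
exact: val_inj.
Qed.

Lemma lk_attach_proper u w (g : {ffun lk_vtx u -> lk_vtx w}) :
  lk_attach g -> g @: [set: lk_vtx u] != [set: lk_vtx w].
Proof.
case=> h [hh hE gE]; have := attach_proper hh; rewrite -!finset.subTset.
case/subsetPn=> y _ yN.
have yw : y \notin lk_base w @: [set: vtx s].
  apply: contra yN => /imsetP[x _ ->]; rewrite -hE.
  by apply: imset_f; rewrite finset.in_setT.
apply/subsetPn; exists (exist _ y yw : lk_vtx w); first by rewrite finset.in_setT.
apply: contra yN => /imsetP[x _ /(congr1 val) /= ->]; rewrite gE.
by apply: imset_f; rewrite finset.in_setT.
Qed.

Lemma lk_attach_comp (r u w : lk_simplex) (f : {ffun lk_vtx r -> lk_vtx u})
    (g : {ffun lk_vtx u -> lk_vtx w}) :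
  lk_attach f -> lk_attach g -> lk_attach [ffun x => g (f x)].
Proof.
case=> h [hh hE fE] [k [kk kE gE]]; exists [ffun x => k (h x)].
split; first exact: attach_comp.
- by move=> x; rewrite ffunE hE kE.
- by move=> y; rewrite !ffunE gE fE.
Qed.

Lemma lk_attach_uniq (w u1 u2 : lk_simplex) (g1 : {ffun lk_vtx u1 -> lk_vtx w})
    (g2 : {ffun lk_vtx u2 -> lk_vtx w}) :
  lk_attach g1 -> lk_attach g2 ->
  g1 @: [set: lk_vtx u1] = g2 @: [set: lk_vtx u2] ->
  existT (fun u => {ffun lk_vtx u -> lk_vtx w}) u1 g1 = existT _ u2 g2.
Proof.
have im u (g : {ffun lk_vtx u -> lk_vtx w}) h : attach h ->
    (forall x, h (lk_base u x) = lk_base w x) ->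
    (forall y, val (g y) = h (val y)) ->
    h @: [set: vtx (projT1 u)] =
      lk_base w @: [set: vtx s] :|: val @: (g @: [set: lk_vtx u]).
  move=> hh hE gE; apply/setP=> z; rewrite finset.in_setU; apply/imsetP/orP.
    case=> y _ ->; have [/imsetP[x _ ->]|yN] := boolP (y \in lk_base u @: [set: vtx s]).
      by left; rewrite hE imset_f ?finset.in_setT.
    right; apply/imsetP; exists (g (exist _ y yN : lk_vtx u)).
      by rewrite imset_f ?finset.in_setT.
    by rewrite gE.
  case=> [/imsetP[x _ ->]|/imsetP[_ /imsetP[y _ ->] ->]].
    by exists (lk_base u x).
  by exists (val y).
case: u1 u2 g1 g2 => t1 [k1 hk1] [t2 [k2 hk2]] g1 g2.
case=> h1 /= [hh1 hE1 gE1] [h2 /= [hh2 hE2 gE2]] eq_im.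
have hi : h1 @: [set: vtx t1] = h2 @: [set: vtx t2].
  by rewrite (im _ g1 h1) // (im _ g2 h2) // eq_im.
have E := attach_uniq hh1 hh2 hi.
have et : t1 = t2 by have := congr1 (@projT1 _ _) E.
subst t2; have eh := existT_inj E; subst h2; clear E hi.
have ek : k1 = k2.
  by apply/ffunP=> x; apply: (attach_inj hh1); rewrite hE1 hE2.
subst k2; have ep : hk1 = hk2 by apply: Prop_irrelevance.
subst hk2; congr existT; apply/ffunP=> y; apply: val_inj.
exact: etrans (gE1 y) (esym (gE2 y)).
Qed.

Lemma lk_attach_face (w : lk_simplex) (A : {set lk_vtx w}) :
  A != finset.set0 -> A != [set: lk_vtx w] ->
  exists! p : {u : lk_simplex & {ffun lk_vtx u -> lk_vtx w}},
    lk_attach (projT2 p) /\ projT2 p @: [set: lk_vtx (projT1 p)] = A.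
Proof.
pose t := projT1 w; pose f : {ffun vtx s -> vtx t} := lk_base w.
have hf : attach f by exact: svalP (projT2 w).
move=> A0 AT.
have /set0Pn[a aA] := A0.
have /subsetPn[b _ bA] : ~~ ([set: lk_vtx w] \subset A).
  by rewrite finset.subTset.
pose F := f @: [set: vtx s].
have valN (y : lk_vtx w) : val y \notin F by exact: (valP y).
pose B := F :|: val @: A.
have B0 : B != finset.set0.
  by apply/set0Pn; exists (val a); rewrite finset.in_setU [X in _ || X]imset_f ?orbT.
have BT : B != [set: vtx t].
  rewrite -finset.subTset; apply/subsetPn; exists (val b); first by rewrite finset.in_setT.
  rewrite finset.in_setU negb_or valN /=; apply: contra bA => /imsetP[c cA].
  by move/val_inj=> ->.
have [[r h] /= [[hh him] _]] := attach_face B0 BT.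
have [x0 _] : exists x0, x0 \in vtx s by apply/card_gt0P; apply: vtx_gt0.
pose C := h @^-1: F.
have FB z : z \in F -> exists2 y, y \in C & z = h y.
  move=> zF; have : z \in h @: [set: vtx r] by rewrite him finset.in_setU zF.
  by case/imsetP=> y _ zE; exists y => //; rewrite finset.inE -zE.
have C0 : C != finset.set0.
  have [|y yC _] := FB (f x0); first by rewrite imset_f ?finset.in_setT.
  by apply/set0Pn; exists y.
have CT : C != [set: vtx r].
  rewrite -finset.subTset; apply/subsetPn.
  have : val a \in h @: [set: vtx r] by rewrite him finset.in_setU [X in _ || X]imset_f ?orbT.
  case/imsetP=> y _ aE; exists y; first by rewrite finset.in_setT.
  by rewrite finset.inE -aE valN.
have [[s' k'] /= [[hk' kim'] _]] := attach_face C0 CT.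
have hkim : [ffun x => h (k' x)] @: [set: vtx s'] = F.
  apply/setP=> z; apply/imsetP/idP.
    case=> x _ ->; rewrite ffunE.
    have : k' x \in C by rewrite -kim' imset_f ?finset.in_setT.
    by rewrite finset.inE.
  case/FB=> y; rewrite -kim' => /imsetP[x _ ->] ->.
  by exists x; rewrite ?ffunE ?finset.in_setT.
have E := attach_uniq (attach_comp hk' hh) hf hkim.
have es : s' = s by have := congr1 (@projT1 _ _) E.
subst s'; have {}E := existT_inj E.
have hkE x : h (k' x) = f x by rewrite -E ffunE.
pose u : lk_simplex := existT _ r (exist _ k' hk').
have uN (y : lk_vtx u) : h (val y) \notin F.
  apply: contra (valP y) => /imsetP[x _]; rewrite -hkE => /(attach_inj hh) ->.
  by rewrite imset_f ?finset.in_setT.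
pose g : {ffun lk_vtx u -> lk_vtx w} :=
  [ffun y => exist _ (h (val y)) (uN y)].
have hg : lk_attach g by exists h; split=> // y; rewrite ffunE.
have gim : g @: [set: lk_vtx u] = A.
  apply/setP=> z; apply/imsetP/idP.
    case=> y _ ->; rewrite ffunE.
    have : h (val y) \in B by rewrite -him imset_f ?finset.in_setT.
    rewrite finset.in_setU (negPf (uN y)) /= => /imsetP[c cA cE].
    suff <- : c = exist _ (h (val y)) (uN y) by [].
    by apply: val_inj; exact: esym cE.
  move=> zA; have : val z \in h @: [set: vtx r].
    by rewrite him finset.in_setU [X in _ || X]imset_f ?orbT.
  case/imsetP=> y _ zE.
  have yN : y \notin k' @: [set: vtx s].
    apply: contra (valN z) => /imsetP[x _ yE]; rewrite zE yE hkE.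
    by rewrite imset_f ?finset.in_setT.
  exists (exist _ y yN : lk_vtx u); first by rewrite finset.in_setT.
  by apply: val_inj; rewrite ffunE /= zE.
exists (existT _ u g); split; first by split.
case=> u' g' /= [hg' gim']; apply: lk_attach_uniq => //.
by rewrite gim gim'.
Qed.

Definition link : scomplex :=
  SComplex lk_vtx_gt0 lk_attach_inj lk_attach_proper lk_attach_comp
    lk_attach_face.

End Link.

Section Flag.
Variable K : scomplex.

Definition is_vertex (p : K) : Prop := #|vtx p| = 1.

Definition is_edge (t : K) : Prop := #|vtx t| = 2.

Definition face_of (s t : K) : Prop :=
  s = t \/ exists f : {ffun vtx s -> vtx t}, attach f.

Definition joins (t p q : K) : Prop :=
  [/\ is_vertex p, is_vertex q, is_edge t
    & exists (f : {ffun vtx p -> vtx t}) (g : {ffun vtx q -> vtx t}),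
        [/\ attach f, attach g & forall x y, f x != g y]].

Definition adjacent (p q : K) : Prop := exists t, joins t p q.

(* The boundary of a simplex is the union of its proper faces. *)
Definition same_boundary (s t : K) : Prop :=
  forall r : K, (exists f : {ffun vtx r -> vtx s}, attach f) <->
                (exists g : {ffun vtx r -> vtx t}, attach g).

Definition simple_complex : Prop :=
  (forall t p : K, ~ joins t p p) /\
  (forall s t : K, 1 < #|vtx s| -> 1 < #|vtx t| -> same_boundary s t -> s = t).

Definition flag : Prop :=
  forall (n : nat) (c : 'I_n.+1 -> K),
    (forall i, is_vertex (c i)) -> injective c ->
    (forall i j, i != j -> adjacent (c i) (c j)) ->
    exists t : K, forall p : K,
      is_vertex p -> (face_of p t <-> exists i, c i = p).

Definition cycle_without_diagonals (n : nat) (c : 'I_n -> K) : Prop :=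
  [/\ forall i, is_vertex (c i), injective c,
      forall i, adjacent (c i) (c (ordS i))
    & forall i j, j != i -> j != ordS i -> i != ordS j ->
        ~ adjacent (c i) (c j)].

End Flag.

Definition locally_6_large (K : scomplex) : Prop :=
  forall v : K, is_vertex v ->
    [/\ simple_complex (link v), flag (link v)
      & forall (n : nat) (c : 'I_n -> link v),
          n = 4 \/ n = 5 -> ~ cycle_without_diagonals c].

(** * Square complexes *)

(* [endpt e b] is the image of the end [b] of the edge [e].  The corners of a
   square are numbered cyclically by ['I_4] and its side [i] goes from the corner
   [i] to the corner [ordS i]; it is glued to the edge [side s i] so that
   [start s i] is the end of that edge at the corner [i].  The two equations say
   that the attaching maps are closed under composition. *)
Record square_complex := SquareComplex {
  vert : Type;
  edge : Type;
  square : Type;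
  endpt : edge -> bool -> vert;
  side : square -> 'I_4 -> edge;
  start : square -> 'I_4 -> bool;
  corner : square -> 'I_4 -> vert;
  endpt_start : forall s i, endpt (side s i) (start s i) = corner s i;
  endpt_finish : forall s i,
    endpt (side s i) (~~ start s i) = corner s (ordS i)
}.

Record VH_complex := VHComplex {
  VH_square :> square_complex;
  vertical : edge VH_square -> bool;
  vertical_alt : forall s i, vertical (side s (ordS i)) = ~~ vertical (side s i)
}.

Record multigraph := Multigraph {
  gnode : Type;
  garc : Type;
  gjoins : garc -> gnode -> gnode -> Prop
}.

Definition embedded_cycle (G : multigraph) (n : nat) : Prop :=
  exists (x : 'I_n -> gnode G) (a : 'I_n -> garc G),
    [/\ injective x, injective a & forall i, gjoins (a i) (x i) (x (ordS i))].

Section SquareLink.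
Variables (X : square_complex) (v : vert X).

Definition edge_end : Type := {p : edge X * bool | endpt p.1 p.2 = v}.

Definition square_corner : Type := {p : square X * 'I_4 | corner p.1 p.2 = v}.

Definition corner_joins (c : square_corner) (x y : edge_end) : Prop :=
  let: (s, i) := sval c in
  let: out := (side s i, start s i) in
  let: inc := (side s (ord_pred i), ~~ start s (ord_pred i)) in
  (sval x = out /\ sval y = inc) \/ (sval x = inc /\ sval y = out).

Definition square_link : multigraph := Multigraph corner_joins.

End SquareLink.

Definition nonpositively_curved (X : square_complex) : Prop :=
  forall (v : vert X) (n : nat), 0 < n < 4 -> ~ embedded_cycle (square_link v) n.

(** * The simplexification of a VH-complex *)

Section Simplexification.
Variable X : VH_complex.

Definition vedge : Type := {e : edge X | vertical e}.

Definition hedge : Type := {e : edge X | ~~ vertical e}.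

Inductive point : Type :=
| PVert of vert X
| PMid of vedge
| PCen of square X.

(* Names for the vertices of the simplices sigma^+ and sigma^- of a vertical edge
   [e]: the endpoint [e b], the midpoint of [e], and, for every occurrence of [e]
   as a side [i] of a square [s], the centre of [s]. *)
Inductive node : Type :=
| End of bool
| Mid
| Occ of square X & 'I_4.

Definition on_edge (e : edge X) (x : node) : Prop :=
  if x is Occ s i then side s i = e else True.

(* The faces of positive dimension of sigma^+ and sigma^-.  Since these two
   simplices share exactly the vertices other than [End true] and [End false],
   they are the finite sets of nodes not containing both ends.  (If infinitely
   many squares are adjacent to [e], then sigma^+ and sigma^- do not exist, but
   [is_fan] still makes sense.) *)
Definition is_fan (e : edge X) (A : {fset {classic node}}) : Prop :=
  [/\ 1 < #|` A|, forall x : node, (x : {classic node}) \in A -> on_edge e x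
    & ~ (((End false : {classic node}) \in A) /\
         ((End true : {classic node}) \in A))].

(* The simplices of X^*.  The subdivision of X consists of the points, of the
   horizontal edges, of the triangles [HTri s i] spanned by the centre of [s] and
   a horizontal side, and of the simplices with at most one [Occ]: half-edges
   {End b, Mid}, spokes {Mid, Occ s i} and {End b, Occ s i} (every corner of [s]
   is an end of exactly one vertical side), and triangles {End b, Mid, Occ s i}.
   Gluing sigma^+ and sigma^- along the triangles {End b, Mid, Occ s i} identifies
   precisely those faces with the simplices of the subdivision, whereas the faces
   with at least two [Occ] are new and pairwise distinct: only their vertices,
   given by [slabel], get identified further. *)
Inductive ssimplex : Type :=
| Point of point
| HEdge of hedge
| HTri (s : square X) (i : 'I_4) of ~~ vertical (side s i)
| Fan (e : vedge) (A : {fset {classic node}}) of is_fan (sval e) A.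

(* In [HTri s i], the vertex [None] is the centre of [s] and the vertices
   [Some false], [Some true] are the corners [i] and [ordS i]. *)
Definition svtx (t : ssimplex) : finType :=
  match t with
  | Point _ => unit
  | HEdge _ => bool
  | HTri _ _ _ => option bool
  | Fan _ A _ => A
  end.

Definition slabel (t : ssimplex) : svtx t -> point :=
  match t with
  | Point p => fun _ => p
  | HEdge h => fun b => PVert (endpt (sval h) b)
  | HTri s i _ => fun x =>
      if x is Some c then PVert (corner s (if c then ordS i else i)) else PCen s
  | Fan e A _ => fun x =>
      match (val x : node) with
      | End b => PVert (endpt (sval e) b)
      | Mid => PMid e
      | Occ s _ => PCen s
      end
  end.

(* The spoke of [HTri s i] at the corner [i] (if [c = false]) or [ordS i]
   (if [c = true]) is the face {End b, Occ s j} of the simplices of the vertical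
   edge [side s j] through this corner, where [b] is the end of that edge there. *)
Definition spoke_side (i : 'I_4) (c : bool) : 'I_4 :=
  if c then ordS i else ord_pred i.

Definition spoke_end (s : square X) (i : 'I_4) (c : bool) : bool :=
  if c then start s (ordS i) else ~~ start s (ord_pred i).

Definition sattach (s t : ssimplex) : {ffun svtx s -> svtx t} -> Prop :=
  match s return {ffun svtx s -> svtx t} -> Prop with
  | Point p => fun f => 1 < #|svtx t| /\ slabel (f tt) = p
  | HEdge h =>
      match t return {ffun bool -> svtx t} -> Prop with
      | HTri s i _ => fun f =>
          sval h = side s i /\ forall b, f b = Some (b (+) start s i)
      | _ => fun _ => False
      end
  | HTri _ _ _ => fun _ => False
  | Fan e A _ =>
      match t return {ffun A -> svtx t} -> Prop with
      | HTri s i _ => fun f => exists c : bool,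
          let j := spoke_side i c in let b := spoke_end s i c in
          [/\ sval e = side s j,
              A = [fset (End b : {classic node}); (Occ s j : {classic node})]
            & forall x : A, f x = if (val x : node) is End _ then Some c else None]
      | Fan e' A' _ => fun f =>
          [/\ e = e', A != A' & forall x : A, val (f x) = val x]
      | _ => fun _ => False
      end
  end.

Lemma svtx_gt0 t : 0 < #|svtx t|.
Proof.
case: t => [p|h|s i hi|e A [hA _ _]] /=; rewrite ?card_unit ?card_bool ?card_option //.
by rewrite -cardfE; apply: ltnW.
Qed.

Lemma spoke_corner s i c :
  endpt (side s (spoke_side i c)) (spoke_end s i c) =
  corner s (if c then ordS i else i).
Proof.
by case: c; rewrite /= ?endpt_start // endpt_finish ord_predK.
Qed.

Lemma spoke_vertical s i c :
  ~~ vertical (side s i) -> vertical (side s (spoke_side i c) : edge X).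
Proof.
case: c => /= hi; first by rewrite vertical_alt.
by move: hi; rewrite -{1}(ord_predK i) vertical_alt negbK.
Qed.

Lemma fset2_val (T : choiceType) (A : {fset T}) (a b : T) (x : A) :
  A = [fset a; b] -> fsval x = a \/ fsval x = b.
Proof.
move=> AE; have : fsval x \in [fset a; b] by rewrite -AE; apply: valP.
by rewrite in_fset2 => /orP[/eqP|/eqP]; [left|right].
Qed.

Lemma val_fsub (T : choiceType) (A B : {fset T}) (f : {ffun A -> B}) :
  (forall x, fsval (f x) = fsval x) -> A `<=` B.
Proof.
move=> fE; apply/fsubsetP=> x xA.
by have <- : fsval (f [` xA]) = x by rewrite fE.
Qed.

Lemma spoke_fan (e : edge X) s j b : e = side s j ->
  is_fan e [fset (End b : {classic node}); (Occ s j : {classic node})].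
Proof.
move=> ->; split.
- rewrite cardfs2; suff -> : (End b : {classic node}) != Occ s j by [].
  by apply/eqP.
- by move=> x; rewrite !in_fset2 => /orP[/eqP->|/eqP->].
- rewrite !in_fset2 => -[/orP[/eqP[<-]|/eqP//] /orP[/eqP//|/eqP//]].
Qed.

Lemma sattach_inj s t (f : {ffun svtx s -> svtx t}) : sattach f -> injective f.
Proof.
case: s f => [p|h|s i hi|e A hA] f //.
- by move=> _ [] [].
- case: t f => [//|//|s i hi|//] f /= [_ fE] x y; rewrite !fE => -[].
  exact: addIb.
case: t f => [//|//|s i hi|e' A' hA'] f /=.
  case=> c [_ AE fE] x y; rewrite !fE => xy; apply: val_inj; move: xy.
  by case: (fset2_val x AE) => xE; case: (fset2_val y AE) => yE; rewrite /= xE yE.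
by case=> _ _ fE x y /(congr1 val) /=; rewrite !fE => /val_inj.
Qed.

Lemma sattach_proper s t (f : {ffun svtx s -> svtx t}) :
  sattach f -> f @: [set: svtx s] != [set: svtx t].
Proof.
case: s f => [p|h|s i hi|e A hA] f //.
- case=> t1 _; apply/eqP=> E; move: t1.
  rewrite -cardsT -E; apply/negP; rewrite -leqNgt.
  by rewrite (leq_trans (leq_imset_card _ _)) // cardsT card_unit.
- case: t f => [//|//|s i hi|//] f /= [_ fE].
  apply/eqP=> /setP/(_ None); rewrite finset.in_setT => /imsetP[x _].
  by rewrite fE.
case: t f => [//|//|s i hi|e' A' hA'] f /=.
  case=> c [_ AE fE]; apply/eqP=> /setP/(_ (Some (~~ c))).
  rewrite finset.in_setT => /imsetP[x _]; rewrite fE.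
  by case: (val x : node) => // _ [] /eqP; rewrite eq_sym; case: c {AE fE}.
case=> _ /eqP AA' fE; apply/eqP=> /setP E; apply: AA'; apply/fsetP=> x.
apply/idP/idP=> xA.
  exact: fsubsetP (val_fsub fE) x xA.
have := E [` xA]; rewrite finset.in_setT => /imsetP[y _ /(congr1 val)] /=.
by rewrite fE => ->.
Qed.

Lemma sattach_label s t (f : {ffun svtx s -> svtx t}) x :
  sattach f -> slabel (f x) = slabel x.
Proof.
case: s f x => [p|h|s i hi|e A hA] f x //.
- by case: x => -[].
- case: t f => [//|//|s i hi|//] f /= [hE fE]; rewrite fE hE; congr PVert.
  have [->|->] : x = start s i \/ x = ~~ start s i.
    by case: x (start s i) => [] []; [left|right|right|left].
    by rewrite addbb endpt_start.
  by rewrite addNb addbb endpt_finish.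
case: t f => [//|//|s i hi|e' A' hA'] f /=.
  case=> c [eE AE fE]; rewrite fE.
  by case: (fset2_val x AE) => xE; rewrite /= xE // eE spoke_corner.
by case=> <- _ fE; rewrite fE.
Qed.

Lemma sattach_card s t (f : {ffun svtx s -> svtx t}) :
  sattach f -> 1 < #|svtx t|.
Proof.
case: s f => [p|h|s i hi|e A hA] f //; first by case.
- by case: t f => [//|//|s i hi|//] f _; rewrite card_option card_bool.
case: t f => [//|//|s i hi|e' A' hA'] f _; first by rewrite card_option card_bool.
by rewrite /= -cardfE; have [] := hA'.
Qed.

Lemma sattach_comp r s t (f : {ffun svtx r -> svtx s})
    (g : {ffun svtx s -> svtx t}) :
  sattach f -> sattach g -> sattach [ffun x => g (f x)].
Proof.
case: r f => [p|h|r i hi|e A hA] f // hf hg.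
- split; first exact: sattach_card hg.
  by rewrite ffunE (sattach_label _ hg) (sattach_label _ hf).
- by case: s f g hf hg => [//|//|s i hi|//] f g.
case: s f g hf hg => [//|//|s i hi|e' A' hA'] f g // [eE /eqP AA' fE].
have sAA' : A `<=` A'.
  exact: val_fsub fE.
case: t g => [//|//|s i hi|e'' A'' hA''] g.
  case=> c [_ AE _]; case: AA'; apply/eqP; rewrite eqEfcard sAA' AE.
  have [c_gt1 _ _] := hA.
  by apply: leq_trans c_gt1; rewrite cardfs2; case: (_ != _).
case=> eE' /eqP A'A'' gE; split; first by rewrite eE.
  apply/eqP=> AA''; apply: AA'; apply/eqP; rewrite eqEfsubset sAA' AA''.
  exact: val_fsub gE.
by move=> x; rewrite ffunE gE fE.
Qed.

Lemma sattach_uniq r s t (f : {ffun svtx r -> svtx t})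
    (g : {ffun svtx s -> svtx t}) :
  sattach f -> sattach g -> f @: [set: svtx r] = g @: [set: svtx s] ->
  existT (fun s => {ffun svtx s -> svtx t}) r f = existT _ s g.
Proof.
move=> hf hg E.
have cE : #|svtx r| = #|svtx s|.
  rewrite -!cardsT -(card_imset _ (sattach_inj hf)) E.
  by rewrite card_imset //; apply: sattach_inj hg.
have mem_g x : g x \in f @: [set: svtx r] by rewrite E imset_f ?finset.in_setT.
have mem_f x : f x \in g @: [set: svtx s] by rewrite -E imset_f ?finset.in_setT.
case: r s => [p|h|r i hi|e A hA] [p'|h'|r' i' hi'|e' A' hA'] // in f g hf hg E cE mem_g mem_f *.
- have fg : f tt = g tt by case/imsetP: (mem_f tt) => -[].
  have pE : p = p' by case: hf hg => _ <- [_ <-]; rewrite fg.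
  by subst p'; congr existT; apply/ffunP=> -[].
- by move: cE; rewrite card_unit card_bool.
- by have [c_gt1 _ _] := hA'; move: cE c_gt1; rewrite card_unit /= -cardfE => <-.
- by move: cE; rewrite card_unit card_bool.
- case: t f g hf hg {E mem_g mem_f} => [//|//|s i hi|//] f g [hE fE] [hE' gE].
  have eh : h = h' by apply: eq_sig_hprop; [move=> ? ? ?; apply: eq_irrelevance|rewrite hE].
  by subst h'; congr existT; apply/ffunP=> x; rewrite fE gE.
- case: t f g hf hg {E mem_f} mem_g => [//|//|s i hi|//] f g [hE fE] [c [_ AE gE]] mem_g.
  have oA : (Occ s (spoke_side i c) : {classic node}) \in A' by rewrite AE fset22.
  by have /imsetP[b _] := mem_g [` oA]; rewrite gE fE.
- by have [c_gt1 _ _] := hA; move: cE c_gt1; rewrite card_unit /= -cardfE => ->.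
- case: t f g hf hg {E mem_g} mem_f => [//|//|s i hi|//] f g [c [_ AE fE]] [hE gE] mem_f.
  have oA : (Occ s (spoke_side i c) : {classic node}) \in A by rewrite AE fset22.
  by have /imsetP[b _] := mem_f [` oA]; rewrite gE fE.
case: t f g hf hg E mem_g mem_f => [//|//|s i hi|e'' A'' hA''] f g hf hg E mem_g mem_f.
  case: hf hg => c [eE AE fE] [c' [eE' AE' gE]].
  have oA : (End (spoke_end s i c) : {classic node}) \in A by rewrite AE fset21.
  have cc : c = c'.
    have /imsetP[x _] := mem_f [` oA]; rewrite fE gE /=.
    by case: (val x : node) => // _ [].
  subst c'; have ee : e = e'.
    by apply: eq_sig_hprop; [move=> ? ? ?; apply: eq_irrelevance|rewrite eE].
  subst e'; have EA : A = A' by rewrite AE.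
  clear AE'; subst A'; have eh : hA = hA' by apply: Prop_irrelevance.
  by subst hA'; congr existT; apply/ffunP=> x; rewrite fE gE.
case: hf hg => eE _ fE [eE' _ gE].
subst e e'; have EA : A = A'.
  apply/fsetP=> x; apply/idP/idP=> xA.
    have /imsetP[y _ /(congr1 val)] /= := mem_f [` xA].
    by rewrite fE gE => /= ->.
  have /imsetP[y _ /(congr1 val)] /= := mem_g [` xA].
  by rewrite fE gE => /= ->.
subst A'; have eh : hA = hA' by apply: Prop_irrelevance.
by subst hA'; congr existT; apply/ffunP=> x; apply: val_inj; rewrite fE gE.
Qed.

Lemma sattach_face t (A : {set svtx t}) :
  A != finset.set0 -> A != [set: svtx t] ->
  exists! p : {s : ssimplex & {ffun svtx s -> svtx t}},
    sattach (projT2 p) /\ projT2 p @: [set: svtx (projT1 p)] = A.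
Proof.
move=> A0 AT.
suff [p [hp pA]] : exists p : {s : ssimplex & {ffun svtx s -> svtx t}},
    sattach (projT2 p) /\ projT2 p @: [set: svtx (projT1 p)] = A.
  exists p; split=> // -[s g] [hg gA]; case: p hp pA => r f hf fA.
  by apply: sattach_uniq => //; rewrite /= in fA gA; rewrite fA gA.
have /set0Pn[a aA] := A0.
have A1 : 0 < #|A| by rewrite card_gt0.
have AltT : #|A| < #|svtx t|.
  by rewrite -cardsT proper_card // properEneq AT finset.subsetT.
have [A_gt1|A_le1] := ltnP 1 #|A|; last first.
  have /cards1P[x xE] : #|A| == 1 by rewrite eqn_leq A_le1.
  exists (existT _ (Point (slabel x)) [ffun=> x]); split=> /=.
    by rewrite ffunE; split=> //; apply: leq_ltn_trans AltT.
  rewrite xE; apply/setP=> y; rewrite finset.in_set1; apply/imsetP/eqP.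
    by case=> z _; rewrite ffunE.
  by move=> ->; exists tt; rewrite ?ffunE ?finset.in_setT.
case: t A A0 AT a aA A1 AltT A_gt1 => [p|h|s i hi|e B hB] A A0 AT a aA A1 AltT A_gt1.
- by move: (ltn_trans A_gt1 AltT); rewrite card_unit.
- by move: (leq_ltn_trans A_gt1 AltT); rewrite card_bool.
- have /subsetPn[z _ zA] : ~~ ([set: option bool] \subset A).
    by rewrite finset.subTset.
  have AE y : (y \in A) = (y != z).
    suff -> : A = [set~ z] by rewrite finset.in_setC1.
    have sA : A \subset [set~ z].
      by apply/subsetP=> x xA; rewrite finset.in_setC1; apply: contraNneq zA => <-.
    apply/eqP; rewrite eqEcard sA /= cardsC1.
    by rewrite (leq_trans _ A_gt1) // card_option card_bool.
  case: z zA AE => [d|] _ AE.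
    pose c := ~~ d.
    pose e : vedge := exist _ (side s (spoke_side i c)) (spoke_vertical c hi).
    have hF := spoke_fan (spoke_end s i c) (erefl (sval e)).
    pose fE (x : svtx (Fan hF)) : option bool :=
      if (fsval x : node) is End _ then Some c else None.
    pose f : {ffun svtx (Fan hF) -> svtx (HTri hi)} := [ffun x => fE x].
    exists (existT _ (Fan hF) f); split=> /=.
      by exists c; split=> // x; rewrite ffunE.
    apply/setP=> y; rewrite AE; apply/imsetP/idP.
      case=> x _ ->; rewrite ffunE /fE /c; case: (fsval x : node) => //= _.
      by case: (d).
    case: y => [b|] bd.
      exists [` fset21 (End (spoke_end s i c) : {classic node})
                  (Occ s (spoke_side i c) : {classic node})].
        by rewrite finset.in_setT.
      rewrite ffunE /fE /c; congr Some.
      by case: b d bd {c e hF fE f AE} => [] [].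
    exists [` fset22 (End (spoke_end s i c) : {classic node})
                (Occ s (spoke_side i c) : {classic node})].
      by rewrite finset.in_setT.
    by rewrite ffunE.
  pose h : hedge := exist _ (side s i) hi.
  exists (existT _ (HEdge h) [ffun b : bool => Some (b (+) start s i)]); split=> /=.
    by split=> // b; rewrite ffunE.
  apply/setP=> y; rewrite AE; apply/imsetP/idP.
    by case=> b _ ->; rewrite ffunE.
  case: y => // b _; exists (b (+) start s i); first by rewrite finset.in_setT.
  by rewrite ffunE addbK.
pose C : {fset {classic node}} := [fset val x | x in A].
have CP x : reflect (exists2 y : B, y \in A & x = val y) (x \in C).
  by apply: imfsetP.
have sCB : C `<=` B by apply/fsubsetP=> x /CP[y _ ->]; apply: valP.
have cC : #|` C| = #|A| by rewrite card_imfset /= -?cardE //; apply: val_inj.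
have hC : is_fan (sval e) C.
  have [_ hB1 hB2] := hB; split; first by rewrite cC.
    by move=> x /(fsubsetP sCB); apply: hB1.
  by case=> /(fsubsetP sCB) b0 /(fsubsetP sCB) b1; apply: hB2.
exists (existT _ (Fan hC) [ffun x : C => fincl sCB x]); split=> /=.
  split=> //; last by move=> x; rewrite ffunE.
  apply/eqP=> CB; move: AltT; rewrite -cC CB cardfE /=.
  by rewrite ltnn.
apply/setP=> y; apply/imsetP/idP.
  case=> x _ ->; rewrite ffunE; have /CP[z zA xz] := valP x.
  by have -> : fincl sCB x = z by apply: val_inj.
move=> yA; have yC : val y \in C by apply/CP; exists y.
exists [` yC]; first by rewrite finset.in_setT.
by apply: val_inj; rewrite ffunE.
Qed.

Definition simplexification : scomplex :=
  SComplex svtx_gt0 sattach_inj sattach_proper sattach_comp sattach_face.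

End Simplexification.

(* Main.v *)
(** The link of a vertex [p] of X^* is the simplicial complex on the edge-ends at
   [p] whose simplices are determined by their vertex sets, with the following
   maximal simplices: at the midpoint of a vertical edge, the two simplices of a
   suspension of a simplex; at the centre of a square, two such suspensions (one
   for each vertical side), whose suspension points are matched by two further
   edges; at a vertex of X, one simplex for each vertical edge-end, consisting of
   the edge-end and of the corners of squares at it, and one edge joining each
   corner to its horizontal edge-end.  The only cliques that could fail to span a
   simplex are triangles formed by a horizontal edge-end and two corners at a
   common vertical edge-end, that is, double edges in the link of X.

   Mark the suspension points in the first two cases, and the vertices other than
   the horizontal edge-ends in the third.  Then exactly two vertices of every
   induced path on three vertices are marked, so the length of every cycle without
   diagonals of length at least 4 is divisible by 3. *)

Require Import Defs.
From mathcomp Require Import all_boot finmap.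
From mathcomp Require Import boolp.
From mathcomp Require Import classical_sets cardinality.

Set Implicit Arguments.
Unset Strict Implicit.
Unset Printing Implicit Defensive.

(** * Complexes whose simplices are determined by the labels of their vertices *)

Section Labelling.
Variables (K : scomplex) (V : Type) (lab : forall t : K, vtx t -> V).

Definition label_of (t : K) (l : V) : Prop := exists x : vtx t, lab x = l.

Definition label_adjacent (l m : V) : Prop :=
  l <> m /\ exists t : K, label_of t l /\ label_of t m.

(** Together the three hypotheses turn [K] into an abstract simplicial complex on the set [V]:
    labels survive gluing, simplices are embedded, and a simplex is known from its set of labels.
    Simplicity, flagness and cycles can then be read off from labels. *)
Hypothesis lab_attach : forall (s t : K) (f : {ffun vtx s -> vtx t}) x,
  attach f -> lab (f x) = lab x.
Hypothesis lab_inj : forall t : K, injective (@lab t).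
Hypothesis lab_uniq : forall s t : K,
  (forall l, label_of s l <-> label_of t l) -> s = t.

Definition some_vtx (t : K) : vtx t := sval (cid (elimT card_gt0P (vtx_gt0 t))).

Lemma vertex_label (p : K) (x y : vtx p) : is_vertex p -> x = y.
Proof. by move/eqP/fintype1P=> [z zE]; rewrite (zE x) (zE y). Qed.

Lemma vertex_uniq (p q : K) (x : vtx p) (y : vtx q) :
  is_vertex p -> is_vertex q -> lab x = lab y -> p = q.
Proof.
move=> hp hq xy; apply: lab_uniq => l; split=> -[z <-].
  by exists y; rewrite (vertex_label z x hp).
by exists x; rewrite (vertex_label z y hq).
Qed.

(** The face of [t] spanned by [y] is a vertex with the same label as [p], hence it is [p]. *)
Lemma vertex_attach (p t : K) (x : vtx p) (y : vtx t) :
  is_vertex p -> 1 < #|vtx t| -> lab x = lab y ->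
  exists f : {ffun vtx p -> vtx t}, attach f /\ forall z, f z = y.
Proof.
move=> hp t1 xy.
have A0 : [set y]%SET != finset.set0 by apply/set0Pn; exists y; rewrite finset.in_set1.
have AT : [set y]%SET != [set: vtx t]%SET.
  by apply/eqP=> E; move: t1; rewrite -cardsT -E cards1.
have [[q f] /= [[hf fE] _]] := attach_face A0 AT.
have fy z : f z = y.
  by apply/eqP; rewrite -finset.in_set1 -fE imset_f ?finset.in_setT.
have hq : is_vertex q.
  by rewrite /is_vertex -cardsT -(card_imset _ (attach_inj hf)) fE cards1.
have /card_gt0P[z _] := vtx_gt0 q.
have qp : q = p.
  by apply: (vertex_uniq (x := z) (y := x)); rewrite // xy -(fy z) lab_attach.
by subst q; exists f.
Qed.

Lemma vertex_face (p t : K) (x : vtx p) :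
  is_vertex p -> face_of p t <-> label_of t (lab x).
Proof.
move=> hp; split=> [[<-|[f hf]]|[y yx]]; first by exists x.
  by exists (f x); rewrite lab_attach.
have [t1|t1] := ltnP 1 #|vtx t|.
  by have [f [hf _]] := vertex_attach hp t1 (esym yx); right; exists f.
left; apply: (vertex_uniq (x := x) (y := y)) => //.
by apply/eqP; rewrite eqn_leq t1 vtx_gt0.
Qed.

(** The two ends of a loop would be distinct vertices of one simplex with one label. Every vertex of
    a simplex of positive dimension lies in its boundary, so the boundary determines all labels. *)
Lemma simple_labelled : simple_complex K.
Proof.
split=> [t p [hp _ ht [f [g [hf hg fg]]]]|s t s1 t1 st].
  have /card_gt0P[x _] := vtx_gt0 p; have /eqP := fg x x; apply; apply: lab_inj.
  by rewrite !lab_attach.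
have sub (s' t' : K) : 1 < #|vtx s'| -> same_boundary s' t' ->
    forall l, label_of s' l -> label_of t' l.
  move=> s1' st' l [y <-].
  have A0 : [set y]%SET != finset.set0 by apply/set0Pn; exists y; rewrite finset.in_set1.
  have AT : [set y]%SET != [set: vtx s']%SET.
    by apply/eqP=> E; move: s1'; rewrite -cardsT -E cards1.
  have [[q f] /= [[hf fE] _]] := attach_face A0 AT.
  have /imsetP[z _ ->] : y \in f @: [set: vtx q]%SET by rewrite fE finset.in_set1.
  have [g hg] := (st' q).1 (ex_intro _ f hf).
  by exists (g z); rewrite !lab_attach.
apply: lab_uniq => l; split; apply: sub => // r.
by rewrite (st r).
Qed.

Lemma adjacent_label (p q : K) (x : vtx p) (y : vtx q) :
  is_vertex p -> is_vertex q ->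
  adjacent p q <-> label_adjacent (lab x) (lab y).
Proof.
move=> hp hq; split=> [[t [_ _ _ [f [g [hf hg fg]]]]]|[xy [t [[a ax] [b bY]]]]].
  split; last first.
    by exists t; split; [exists (f x)|exists (g y)]; rewrite lab_attach.
  move=> xy; have /eqP := fg x y; apply; apply: lab_inj.
  by rewrite !lab_attach.
have ab : a != b by apply/eqP=> E; apply: xy; rewrite -ax -bY E.
have [r hr [a' [b' [ax' bY' ab']]]] : exists2 r : K, is_edge r &
    exists a' b' : vtx r, [/\ lab a' = lab x, lab b' = lab y & a' != b'].
  (* [attach_face] yields proper faces only, so the case where [t] is itself the edge is
     separate. *)
  have [AT|AT] := eqVneq [set a; b]%SET [set: vtx t]%SET.
    by exists t; [rewrite /is_edge -cardsT -AT cards2 ab|exists a, b].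
  have A0 : [set a; b]%SET != finset.set0.
    by apply/set0Pn; exists a; rewrite finset.set21.
  have [[r f] /= [[hf fE] _]] := attach_face A0 AT.
  have /imsetP[a' _ aE] : a \in f @: [set: vtx r]%SET by rewrite fE finset.set21.
  have /imsetP[b' _ bE] : b \in f @: [set: vtx r]%SET by rewrite fE finset.set22.
  exists r; first by rewrite /is_edge -cardsT -(card_imset _ (attach_inj hf)) fE cards2 ab.
  exists a', b'; split=> //; rewrite -?ax -?bY ?aE ?bE ?lab_attach //.
  by apply: contraNneq ab => E; rewrite aE bE E.
have r1 : 1 < #|vtx r| by rewrite hr.
have [f [hf fE]] := vertex_attach hp r1 (esym ax').
have [g [hg gE]] := vertex_attach hq r1 (esym bY').
by exists r; split=> //; exists f, g; split=> // u v; rewrite fE gE.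
Qed.

(** Cliques of one or two members always span a vertex or an edge; only those with at least three
    members have to be tested, hence [n.+3]. *)
Lemma flag_labelled :
  (forall (n : nat) (c : 'I_n.+3 -> V),
     (forall i j, i != j -> label_adjacent (c i) (c j)) ->
     exists t : K, forall l, label_of t l <-> exists i, c i = l) ->
  flag K.
Proof.
move=> clique n c hc c_inj hadj.
pose x i := some_vtx (c i).
have labc (p : K) i (y : vtx p) : is_vertex p -> lab y = lab (x i) -> p = c i.
  by move=> hp; apply: vertex_uniq.
suff [t tE] : exists t : K, forall l, label_of t l <-> exists i, lab (x i) = l.
  exists t => p hp; have /card_gt0P[y _] := vtx_gt0 p.
  rewrite (vertex_face _ y hp) tE; split=> [[i yE]|[i iE]]; exists i.
    by rewrite -(labc p i y).
  by subst p; rewrite (vertex_label y (x i)).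
case: n c hc c_inj hadj @x labc => [|[|n]] c hc c_inj hadj x labc.
- exists (c ord0) => l; split=> [[y <-]|[i <-]]; last by rewrite ord1; exists (x ord0).
  by exists ord0; rewrite (vertex_label y (x ord0)).
- pose i1 : 'I_2 := lift ord0 ord0.
  have [t [_ _ ht [f [g [hf hg fg]]]]] : adjacent (c ord0) (c i1) by apply: hadj.
  have zE z : z \in [set f (x ord0); g (x i1)]%SET.
    suff -> : [set f (x ord0); g (x i1)]%SET = [set: vtx t]%SET by rewrite finset.in_setT.
    apply/eqP; rewrite eqEcard finset.subsetT cards2 fg cardsT.
    by rewrite (_ : #|vtx t| = 2).
  exists t => l; split=> [[z <-]|[i <-]].
    have := zE z; rewrite finset.in_set2 => /orP[/eqP->|/eqP->].
      by exists ord0; rewrite lab_attach.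
    by exists i1; rewrite lab_attach.
  have [->|->] : i = ord0 \/ i = i1.
    by case: i => -[|[|//]] ?; [left|right]; apply: val_inj.
  - by exists (f (x ord0)); rewrite lab_attach.
  - by exists (g (x i1)); rewrite lab_attach.
apply: (clique n (fun i => lab (x i))) => i j ij.
by apply/adjacent_label=> //; apply: hadj.
Qed.

(* Consecutive windows of length 3 carry the same number of marks, so the marking
   of a cycle without diagonals is invariant under the shift by 3, hence constant
   if the length is prime to 3; but 2 is not a multiple of 3. *)
Lemma no_short_cycle_labelled (Z : V -> bool) :
  (forall l0 l1 l2, label_adjacent l0 l1 -> label_adjacent l1 l2 ->
     l0 <> l2 -> ~ label_adjacent l0 l2 -> Z l0 + Z l1 + Z l2 = 2) ->
  forall (n : nat) (c : 'I_n -> K), n = 4 \/ n = 5 -> ~ cycle_without_diagonals c.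
Proof.
move=> path3 n c n45 [hc c_inj hadj hdiag].
pose l i := lab (some_vtx (c i)).
have l_inj : injective l.
  by move=> i j; move/vertex_uniq=> E; apply/c_inj/E.
have adjE i j : adjacent (c i) (c j) <-> label_adjacent (l i) (l j).
  exact: adjacent_label.
have window i : Z (l i) + Z (l (ordS i)) + Z (l (ordS (ordS i))) = 2.
  have [d1 d2 d3] : [/\ ordS (ordS i) != i, ordS (ordS i) != ordS i
      & i != ordS (ordS (ordS i))].
    by clear -n45; case: n45 i => ->; do 6![case=> [] // | case] => //.
  apply: path3; first exact/adjE/hadj.
  - exact/adjE/hadj.
  - by move/l_inj/eqP; rewrite eq_sym (negPf d1).
  - by move/adjE; apply: hdiag.
(* Consecutive windows overlap in two positions, so their outer marks agree. *)
have shift3 i : Z (l i) = Z (l (iter 3 (@ordS n) i)).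
  by move: (window i) (window (ordS i)) => /=; do 4![case: (Z _)].
have shift1 i : Z (l i) = Z (l (ordS i)).
  (* The multiples 9 and 6 of 3 are congruent to 1 modulo 4 and modulo 5 respectively. *)
  have [E|E] : iter 9 (@ordS n) i = ordS i \/ iter 6 (@ordS n) i = ordS i.
  - clear -n45; case: n45 i => ->; [left|right]; apply: val_inj; move: i;
      by do 6![case=> [] // | case].
  - by rewrite -E (iterD 6 3) -!shift3.
  - by rewrite -E (iterD 3 3) -!shift3.
have [i _] : exists i : 'I_n, True by case: n45 => ->; exists ord0.
by have := window i; rewrite -!shift1; case: (Z _).
Qed.

End Labelling.

(** * Names for the edge-ends of the simplexification *)

Section Darts.
Variable X : VH_complex.

(* Names for the ends of the edges of X^*: [HDart e b] is the end [b] of the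
   horizontal edge [e], and [FDart e x y] is the end at [x] of the edge {x, y} of
   a simplex of the vertical edge [e].  [NoDart] is the junk
   value of [dart_of] on pairs of vertices that span no edge. *)
Inductive dart : Type :=
| NoDart
| HDart of edge X & bool
| FDart of vedge X & node X & node X.

Lemma vedge_inj (e e' : vedge X) : sval e = sval e' -> e = e'.
Proof. by apply: eq_sig_hprop => ? ? ?; apply: eq_irrelevance. Qed.

Definition spoke (s : square X) (i : 'I_4) (hi : ~~ vertical (side s i)) (c : bool) :
  vedge X := exist _ (side s (spoke_side i c)) (spoke_vertical c hi).

(** A spoke of [HTri s i] is also a face of the simplices of a vertical edge, so its two ends carry
    the names they have there: [out_dart] is the end at the centre of [s], [in_dart] the end at the
    corner. *)
Definition out_dart s i (hi : ~~ vertical (side s i)) c : dart :=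
  FDart (spoke hi c) (Occ s (spoke_side i c)) (End X (spoke_end s i c)).

Definition in_dart s i (hi : ~~ vertical (side s i)) c : dart :=
  FDart (spoke hi c) (End X (spoke_end s i c)) (Occ s (spoke_side i c)).

Definition side_dart (s : square X) (i : 'I_4) (c : bool) : dart :=
  HDart (side s i) (c (+) start s i).

Definition dart_of (t : ssimplex X) : svtx t -> svtx t -> dart :=
  match t return svtx t -> svtx t -> dart with
  | Point _ => fun _ _ => NoDart
  | HEdge h => fun b _ => HDart (sval h) b
  | HTri s i hi => fun x y =>
      match x, y with
      | None, Some c => out_dart hi c
      | Some c, None => in_dart hi c
      | Some c, Some _ => side_dart s i c
      | None, None => NoDart
      end
  | Fan e A _ => fun x y => FDart e (val x) (val y)
  end.

Lemma spoke_side_neq i c : spoke_side i c <> spoke_side i (~~ c).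
Proof.
by move=> /(congr1 val); case: c; case: i => -[|[|[|[|//]]]].
Qed.

(** A vertical side of [s] carries two spokes, one for each adjacent horizontal side; they lie at
    opposite ends of that side, so [spoke_end] tells them apart. *)
Lemma spoke_inj (s : square X) i i' c c' :
  spoke_side i c = spoke_side i' c' -> spoke_end s i c = spoke_end s i' c' ->
  i = i' /\ c = c'.
Proof.
case: c c' => [] [] /=.
- by move/(can_inj (@ordSK _)).
- by rewrite /spoke_end => ->; case: (start _ _).
- by rewrite /spoke_end => ->; case: (start _ _).
- by move/(can_inj (@ord_predK _)).
Qed.

Lemma FDart_inj (e e' : vedge X) x x' y y' :
  FDart e x y = FDart e' x' y' -> [/\ e = e', x = x' & y = y'].
Proof. by move=> E; split; case: E. Qed.

Lemma out_dart_inj s i (hi : ~~ vertical (side s i)) c s' i'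
    (hi' : ~~ vertical (side s' i')) c' :
  out_dart hi c = out_dart hi' c' -> [/\ s = s', i = i' & c = c'].
Proof.
case/FDart_inj=> _ [ss sE] [eE]; rewrite -ss in eE.
by have [] := spoke_inj sE eE.
Qed.

Lemma in_dart_inj s i (hi : ~~ vertical (side s i)) c s' i'
    (hi' : ~~ vertical (side s' i')) c' :
  in_dart hi c = in_dart hi' c' -> [/\ s = s', i = i' & c = c'].
Proof.
case/FDart_inj=> _ [eE] [ss sE]; rewrite -ss in eE.
by have [] := spoke_inj sE eE.
Qed.

(** Gluing identifies edges together with their ends, so names are preserved. The condition [x != y]
    avoids the diagonal, where a spoke glued into [HTri] would take the name of a horizontal end. *)
Lemma dart_attach (s t : ssimplex X) (f : {ffun svtx s -> svtx t}) x y :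
  sattach f -> x != y -> dart_of (f x) (f y) = dart_of x y.
Proof.
case: s f x y => [p|h|s i hi|e A hA] f x y //.
- case: t f => [//|//|s i hi|//] f /= [hE fE] xy.
  by rewrite !fE /side_dart addbK hE.
case: t f => [//|//|s i hi|e' A' hA'] f /=; last by case=> -> _ fE; rewrite !fE.
case=> c [eE AE fE] xy; rewrite !fE.
have -> : e = spoke hi c by apply: vedge_inj.
have xy' : fsval x <> fsval y by move=> /val_inj E; rewrite E eqxx in xy.
case: (fset2_val x AE) (fset2_val y AE) xy' => -> [] -> //=;
  by rewrite ?eqxx.
Qed.

Lemma dart_of_inj (t : ssimplex X) (b y y' : svtx t) :
  y != b -> y' != b -> dart_of b y = dart_of b y' -> y = y'.
Proof.
case: t b y y' => [p|h|s i hi|e A hA] /= b y y'; first by case: y y' => [] [].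
- by case: b y y' => [] [] [].
- case: b y y' => [c|] [d|] [d'|] //=.
  + by case: c d d' => [] [] [].
  + by move=> _ _ /out_dart_inj[_ _ ->].
by move=> _ _ /FDart_inj[_ _ yy']; apply: val_inj.
Qed.

Definition has_dart (t : ssimplex X) (b : svtx t) (d : dart) : Prop :=
  exists2 y, y != b & dart_of b y = d.

Lemma mem_dart (t : ssimplex X) (b y : svtx t) : y != b -> has_dart b (dart_of b y).
Proof. by exists y. Qed.

Lemma fan_darts (e : vedge X) A (hA : is_fan (sval e) A) (b : svtx (Fan hA)) d :
  has_dart b d -> exists2 y, d = FDart e (val b) y & (y : {classic node X}) \in A.
Proof. by case=> y _ <-; exists (val y); rewrite ?(valP y). Qed.

Lemma fan_other (e : vedge X) A (hA : is_fan (sval e) A) (b : svtx (Fan hA)) :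
  exists y, has_dart b (FDart e (val b) y).
Proof.
have /card_gt1P[x [y [_ _ xy]]] : 1 < #|svtx (Fan hA)|.
  by rewrite /= -cardfE; have [] := hA.
have [E|xb] := eqVneq x b; last by exists (val x); exists x.
by exists (val y); exists y => //; rewrite -E eq_sym.
Qed.

(** A dart inside a fan records the edge and both nodes, a spoke of a triangle records the square
    and the side, and an [HDart] records the horizontal edge with its end. Simplices of different
    kinds are told apart by the kinds and base nodes of their darts. *)
Lemma has_dart_uniq (t t' : ssimplex X) (b : svtx t) (b' : svtx t') :
  1 < #|svtx t| -> 1 < #|svtx t'| ->
  (forall d, has_dart b d <-> has_dart b' d) ->
  existT (fun t => svtx t) t b = existT _ t' b'.
Proof.
(* By symmetry each mixed pair of kinds is treated in one order only. *)
wlog: t t' b b' / match t, t' with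
  | HEdge _, HTri _ _ _ | HEdge _, Fan _ _ _ | HTri _ _ _, Fan _ _ _ => false
  | _, _ => true end.
  move=> W t1 t1' E; case: t b t1 E => [p|h|s i hi|e A hA] b t1 E;
  case: t' b' t1' E => [p'|h'|s' i' hi'|e' A' hA'] b' t1' E;
    by [apply: W|symmetry; apply: W => // d; rewrite E].
case: t b => [p|h|s i hi|e A hA] b; rewrite ?card_unit //;
  case: t' b' => [p'|h'|s' i' hi'|e' A' hA'] b'; rewrite ?card_unit // => _ _ _ E.
- have nb : ~~ b != b by case: (b).
  have [y _ [hh bb]] := (E (HDart (sval h) b)).1 (mem_dart (t := HEdge h) nb).
  have eh : h' = h by apply: eq_sig_hprop => // ? ? ?; apply: eq_irrelevance.
  by move: b' {E} y bb; rewrite eh => b' y <-.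
- case: b E => [c|] E.
    by have [] := (E (in_dart hi c)).1 (ex_intro2 _ _ None isT erefl).
  by have [] := (E (out_dart hi true)).1 (ex_intro2 _ _ (Some true) isT erefl).
- have other c : Some (~~ c) != Some c by case: c.
  case: b b' E => [c|] [c'|] E.
  + have [[d|] //=] := (E (in_dart hi c)).1 (ex_intro2 _ _ None isT erefl).
    move=> _ /in_dart_inj[ss ii cc]; rewrite cc in E *; subst s' i'.
    by rewrite (bool_irrelevance hi' hi).
  + by have [[d|]] := (E (side_dart s i c)).1 (mem_dart (t := HTri hi) (b := Some c) (y := Some (~~ c)) (other c)).
  + by have [[d|]] := (E (side_dart s' i' c')).2 (mem_dart (t := HTri hi') (b := Some c') (y := Some (~~ c')) (other c')).
  + have [[d|] //=] := (E (out_dart hi true)).1 (ex_intro2 _ _ (Some true) isT erefl).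
    move=> _ /out_dart_inj[ss ii _]; subst s' i'.
    by rewrite (bool_irrelevance hi' hi).
- have [y hy] := fan_other b.
  by have [] := (E _).1 hy.
- case: b' E => [c'|] E.
    have other : Some (~~ c') != Some c' by case: (c').
    have hd := (E (side_dart s' i' c')).2 (mem_dart (t := HTri hi') (b := Some c') (y := Some (~~ c')) other).
    by have [] := fan_darts hd.
  (* At the centre, the two spokes start at occurrences on opposite sides of the square, whereas all
     darts of a fan at [b] start at the same node. *)
  have base c : val b = Occ s' (spoke_side i' c).
    have hd := (E (out_dart hi' c)).2 (ex_intro2 _ _ (Some c) isT erefl).
    by have [y /FDart_inj[]] := fan_darts hd.
  have := base true; rewrite (base false).
  by move/(congr1 (fun x : node X => if x is Occ _ j then j else i'))/(@spoke_side_neq i' false).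
have [y hy] := fan_other b.
have [y' /FDart_inj[ee bb _] _] := fan_darts ((E _).1 hy).
subst e'; have AA' : A = A'.
  apply/fsetP=> z; apply/idP/idP=> zA.
    have [->|zb] := eqVneq z (val b); first by rewrite bb (valP b').
    have zb' : [` zA]%fset != b by apply: contraNneq zb => <-.
    have [z' /FDart_inj[_ _ zz]] := fan_darts ((E _).1 (mem_dart (t := Fan hA) zb')).
    by rewrite (_ : z = z').
  have [->|zb] := eqVneq z (val b'); first by rewrite -bb (valP b).
  have zb' : [` zA]%fset != b' by apply: contraNneq zb => <-.
  have [z' /FDart_inj[_ _ zz]] := fan_darts ((E _).2 (mem_dart (t := Fan hA') zb')).
    by rewrite (_ : z = z').
subst A'; rewrite (Prop_irrelevance hA' hA) in b' bb E *.
by congr existT; apply: val_inj.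
Qed.

Definition opposite (x y : node X) : bool :=
  match x, y with End b, End b' => b != b' | _, _ => false end.

Lemma oppositeC (x y : node X) : opposite x y = opposite y x.
Proof. by case: x y => [?||? ?] [?||? ?] //=; rewrite eq_sym. Qed.

Lemma opposite_irr (x : node X) : opposite x x = false.
Proof. by case: x => //= b; rewrite eqxx. Qed.

Definition node_point (e : vedge X) (x : node X) : Defs.point X :=
  match x with
  | End b => PVert (endpt (sval e) b)
  | Mid => PMid e
  | Occ s _ => PCen s
  end.

(** Excluding both ends is a condition on pairs, so fans are cliques for non-opposition. This is the
    flagness of the suspension of a simplex. *)
Lemma is_fan_opposite (e : edge X) (A : {fset {classic node X}}) :
  is_fan e A <->
  [/\ 1 < #|` A|, forall x : node X, (x : {classic node X}) \in A -> on_edge e x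
    & forall x y : node X, (x : {classic node X}) \in A -> (y : {classic node X}) \in A ->
        ~~ opposite x y].
Proof.
split=> -[A1 Ae AE]; split=> //.
  by case=> [b||s i] [b'||s' i'] // bA bA'; apply/negP; case: b b' bA bA' => [] [] // ? ? _; apply: AE.
by case=> fA tA; have := AE _ _ fA tA.
Qed.

(** * The link of a point as a complex labelled by darts *)

Section Link.
Variable p : Defs.point X.
Local Notation L := (link (Point p : simplexification X)).

Definition base_of (u : L) : svtx (projT1 u) := lk_base u tt.

Definition lk_dart (u : L) (y : vtx u) : dart := dart_of (base_of u) (val y).

Lemma lk_baseE (u : L) y : (y \in lk_base u @: [set: unit]%SET) = (y == base_of u).
Proof.
apply/imsetP/eqP=> [[[] _ ->]|->] //.
by exists tt.
Qed.

Lemma base_prop (u : L) : 1 < #|svtx (projT1 u)| /\ slabel (base_of u) = p.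
Proof. by case: u => t [f hf]; case: hf. Qed.

Lemma label_of_link (u : L) d : label_of lk_dart u d <-> has_dart (base_of u) d.
Proof.
split=> [[[y yb] <-]|[y yb <-]]; first by exists y; rewrite // -lk_baseE.
rewrite -lk_baseE in yb.
by exists (exist _ y yb : lk_vtx u).
Qed.

Lemma lk_dart_attach (u w : L) (f : {ffun vtx u -> vtx w}) x :
  attach f -> lk_dart (f x) = lk_dart x.
Proof.
case=> h [hh hb fE]; rewrite /lk_dart fE /base_of -hb; apply: dart_attach => //.
by rewrite eq_sym -[_ == _]lk_baseE (valP x).
Qed.

Lemma lk_dart_inj (u : L) : injective (@lk_dart u).
Proof.
move=> x y /dart_of_inj E; apply: val_inj; apply: E; rewrite -lk_baseE.
  exact: (valP x).
exact: (valP y).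
Qed.

Lemma lk_dart_uniq (u w : L) :
  (forall d, label_of lk_dart u d <-> label_of lk_dart w d) -> u = w.
Proof.
move=> E.
have : existT (fun t : ssimplex X => svtx t) _ (base_of u) =
      existT (fun t : ssimplex X => svtx t) _ (base_of w).
  apply: has_dart_uniq; [by case: (base_prop u)|by case: (base_prop w)|].
  by move=> d; rewrite -!label_of_link.
case: u w {E} => t [f hf] [t' [f' hf']]; rewrite /base_of /= => E.
have tt' := congr1 (@projT1 _ _) E; rewrite /= in tt'; subst t'.
have {E} := existT_inj E; rewrite /lk_base /= => ff'.
have ef : f = f' by apply/ffunP=> -[].
by subst f'; rewrite (Prop_irrelevance hf' hf).
Qed.

Lemma link_with_base (t : ssimplex X) (b : svtx t) :
  1 < #|svtx t| -> slabel b = p ->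
  exists u : L, forall d, label_of lk_dart u d <-> has_dart b d.
Proof.
move=> t1 bp.
have hf : @attach (simplexification X) (Point p) t [ffun=> b] by split; rewrite ?ffunE.
exists (existT _ t (exist _ _ hf)) => d; rewrite label_of_link.
by rewrite /base_of /lk_base /= ffunE.
Qed.

Lemma fan_link (e : vedge X) (A : {fset {classic node X}}) (x : node X) :
  is_fan (sval e) A -> (x : {classic node X}) \in A -> node_point e x = p ->
  exists u : L, forall d, label_of lk_dart u d <->
    exists y : node X, [/\ (y : {classic node X}) \in A, y <> x & d = FDart e x y].
Proof.
move=> hA xA xp.
have A1 : 1 < #|svtx (Fan hA)| by rewrite /= -cardfE; have [] := hA.
have [u uE] := link_with_base (t := Fan hA) (b := [` xA]%fset) A1 xp.
exists u => d; rewrite uE; split=> [[y yx <-]|[y [yA yx ->]]].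
  exists (val y); split=> //; first exact: fsvalP.
  by move=> E; case/eqP: yx; apply: val_inj.
exists ([` yA]%fset : svtx (Fan hA)) => //.
by apply/eqP=> /(congr1 val).
Qed.

Definition fan_triple (e : vedge X) (x y z : node X) : Prop :=
  [/\ node_point e x = p,
      [/\ on_edge (sval e) x, on_edge (sval e) y & on_edge (sval e) z],
      [/\ x <> y, x <> z & y <> z]
    & [/\ ~~ opposite x y, ~~ opposite x z & ~~ opposite y z]].

(** Each edge of the link is cut out by a triangle with a vertex at [p]: a triangle inside a fan, an
    [HTri] at its centre, or an [HTri] at a corner. The last kind needs two constructors, one for
    each order of the darts. *)
Inductive dart_adjacent : dart -> dart -> Prop :=
| FanAdjacent e x y z of fan_triple e x y z :
    dart_adjacent (FDart e x y) (FDart e x z)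
| OutAdjacent s i (hi : ~~ vertical (side s i)) c of PCen s = p :
    dart_adjacent (out_dart hi c) (out_dart hi (~~ c))
| InAdjacent s i (hi : ~~ vertical (side s i)) c
    of PVert (corner s (if c then ordS i else i)) = p :
    dart_adjacent (in_dart hi c) (side_dart s i c)
| SideAdjacent s i (hi : ~~ vertical (side s i)) c
    of PVert (corner s (if c then ordS i else i)) = p :
    dart_adjacent (side_dart s i c) (in_dart hi c).

Lemma label_adjacent_link l m :
  label_adjacent lk_dart l m <-> dart_adjacent l m.
Proof.
split=> [[lm [u [/label_of_link ul /label_of_link um]]]|].
  have [_] := base_prop u; move: (base_of u) ul um => b.
  case: (projT1 u) b => [q|h|s i hi|e A hA] b [y yb yl] [z zb zm] bp; subst l m.
  - by case: lm.
  - by case: lm.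
  - case: b y z yb zb lm bp => [c|] [d|] [d'|] //=.
    + by move=> _ _ _ bp; apply: SideAdjacent.
    + by move=> _ _ _ bp; apply: InAdjacent.
    + move=> _ _ dd bp; have -> : d' = ~~ d by case: d d' dd => [] [].
      exact: OutAdjacent.
  - have [_ Ae AE] := (is_fan_opposite _ _).1 hA.
    apply: FanAdjacent; split=> //; split; try exact/Ae/fsvalP;
      try by apply: AE; apply: fsvalP.
    + by move=> E; case/eqP: yb; apply: val_inj.
    + by move=> E; case/eqP: zb; apply: val_inj.
    + by move=> E; apply: lm; rewrite /= E.
have tri (s : square X) i (hi : ~~ vertical (side s i)) : 1 < #|svtx (HTri hi)|.
  by rewrite card_option card_bool.
case=> [e x y z [xp [xe ye ze] [xy xz yz] [oxy oxz oyz]]|s i hi c sp|s i hi c sp|s i hi c sp].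
(* The three nodes of the triple themselves span a fan, whose link simplex at [x] contains both
   darts. *)
- pose A : {fset {classic node X}} :=
    [fset (x : {classic node X}); (y : {classic node X}); (z : {classic node X})]%fset.
  have memA w : (w : {classic node X}) \in A <-> [\/ w = x, w = y | w = z].
    rewrite !inE; split=> [/orP[/orP[]|] /eqP ->|[] ->]; rewrite ?eqxx ?orbT //;
      by [constructor 1|constructor 2|constructor 3].
  have [xA yA zA] : [/\ (x : {classic node X}) \in A, (y : {classic node X}) \in A
      & (z : {classic node X}) \in A] by split; apply/memA;
        [constructor 1|constructor 2|constructor 3].
  have hA : is_fan (sval e) A.
    apply/is_fan_opposite; split.
    - rewrite cardfE; apply/card_gt1P; exists [` xA]%fset, [` yA]%fset; split=> //.
      by apply/eqP=> /(congr1 val).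
    - by move=> w /memA[] ->.
    - by move=> v w /memA[] -> /memA[] ->; rewrite ?opposite_irr // oppositeC.
  have [u uE] := fan_link hA xA xp.
  split; first by case/FDart_inj.
  by exists u; split; apply/uE; [exists y|exists z]; split=> // E; [apply: xy|apply: xz].
- have [u uE] := link_with_base (t := HTri hi) (b := None) (tri s i hi) sp.
  split; first by case/out_dart_inj=> _ _; case: c.
  by exists u; split; apply/uE; [exists (Some c)|exists (Some (~~ c))].
- have [u uE] := link_with_base (t := HTri hi) (b := Some c) (tri s i hi) sp.
  split=> //; exists u; split; apply/uE; [by exists None|exists (Some (~~ c))] => //.
  by case: c {uE sp}.
- have [u uE] := link_with_base (t := HTri hi) (b := Some c) (tri s i hi) sp.
  split=> //; exists u; split; apply/uE; [exists (Some (~~ c))|by exists None] => //.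
  by case: c {uE sp}.
Qed.

(** * The marking and induced paths on three vertices *)

Definition is_end (x : node X) : bool := if x is End _ then true else false.

(** At a midpoint or a centre [x] is no end, so the marked darts are the suspension points, which
    lead to an end. At a vertex of X every [FDart] starts at an end and is marked, while the
    horizontal [HDart] are not. *)
Definition marked (d : dart) : bool :=
  if d is FDart _ x y then is_end x || is_end y else false.

Lemma end_neighbour x y b : x <> y -> ~~ opposite x y -> y = End X b -> is_end x = false.
Proof.
move=> xy oxy yE; subst y; case: x xy oxy => //= a ab; rewrite negbK => /eqP E.
by rewrite E in ab.
Qed.

Lemma marked_path l0 l1 l2 :
  dart_adjacent l0 l1 -> dart_adjacent l1 l2 -> l0 <> l2 ->
  ~ dart_adjacent l0 l2 -> marked l0 + marked l1 + marked l2 = 2.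
Proof.
move=> h01 h12 n02 a02.
have [l El] : exists l, l1 = l by exists l1.
have {}h12 : dart_adjacent l l2 by rewrite -El.
case: h01 El n02 a02 => [e x y z T|s i hi c sp|s i hi c sp|s i hi c sp];
  case: h12 => [e' x' y' z' T'|s' i' hi' c' sp'|s' i' hi' c' sp'|s' i' hi' c' sp'] //
    El n02 a02.
- case/FDart_inj: El => ? ? ?; subst e' x' y'.
  case: T T' => xp [xe ye ze] [xy xz yz] [oxy oxz oyz].
  case=> _ [_ _ we] [_ xw zw] [_ oxw ozw].
  (* Nodes [y] and [z'] that were not opposite would make [l0] and [l2] adjacent. So they are the
     two ends, neither [x] nor the middle node is an end, and the marks are 1, 0, 1. *)
  have oyw : opposite y z'.
    apply: contrapT => /negP oyw; apply: a02; apply: FanAdjacent; split=> //; split=> //.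
    by move=> E; apply: n02; rewrite E.
  case: y oxy oyz oyw {ye xy yz n02 a02} => [b||? ?] // oxy oyz oyw.
  case: z' oxw ozw oyw {we xw zw} => [d||? ?] // oxw ozw /= bd.
  case: x oxy oxw {oxz xp xe xz} => [a||? ?] //=; first by case: a b d bd {oyz ozw} => [] [] [].
    by case: z oyz ozw {ze} => [a||? ?] //=; case: a b d bd => [] [] [].
  by case: z oyz ozw {ze} => [a||? ?] //=; case: a b d bd => [] [] [].
(* Two spokes at a centre are preceded by a fan edge: the middle dart leads to an end, so [y] is no
   end and the marks are 0, 1, 1. *)
- case/FDart_inj: El => ? ? ?; subst e x z.
  case: T => _ _ [_ _ yz] [_ _ oyz].
  by rewrite /= (end_neighbour yz oyz erefl).
- by case/FDart_inj: El => ? ? ?; subst e x z.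
- case/FDart_inj: El => ? ? ?; subst e' x' y'.
  case: T' => _ _ [_ _ yz] [_ _ oyz].
  by rewrite /= (end_neighbour (nesym yz) _ erefl) // oppositeC.
- case: n02; case/out_dart_inj: El => ? ? ?; subst s' i' c'.
  by rewrite negbK (bool_irrelevance hi' hi).
- by case/FDart_inj: El => _ <- _.
- by case: n02; case/in_dart_inj: El => ? ? ?; subst s' i' c'.
Qed.

(** * Triangles and cliques in the link *)

Definition fan_adjacent (l m : dart) : Prop :=
  exists e x y z, [/\ l = FDart e x y, m = FDart e x z & fan_triple e x y z].

Lemma out_dart_adjacent s i (hi : ~~ vertical (side s i)) c m :
  dart_adjacent (out_dart hi c) m ->
  fan_adjacent (out_dart hi c) m \/ m = out_dart hi (~~ c).
Proof.
move El: (out_dart hi c) => l lm.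
case: lm El => [e x y z T|s' i' hi' c' _|s' i' hi' c' _|s' i' hi' c' _] //.
  by move=> _; left; exists e, x, y, z.
case/out_dart_inj=> ss ii cc; subst s' i' c'; right.
by rewrite (bool_irrelevance hi' hi).
Qed.

(** Squares glued along a horizontal edge share its darts, so [s'], [i'], [c'] may differ from the
    given [s], [i], [c]. *)
Lemma side_dart_adjacent s i c m :
  dart_adjacent (side_dart s i c) m ->
  exists s' i' (hi' : ~~ vertical (side s' i')) c',
    [/\ side_dart s i c = side_dart s' i' c', m = in_dart hi' c'
      & PVert (corner s' (if c' then ordS i' else i')) = p].
Proof.
move El: (side_dart s i c) => l lm.
case: lm El => [e x y z T|s' i' hi' c' _|s' i' hi' c' _|s' i' hi' c' sp] // _.
by exists s', i', hi', c'.
Qed.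

Lemma fan_adjacentP e x y e' x' y' :
  fan_adjacent (FDart e x y) (FDart e' x' y') ->
  [/\ e' = e, x' = x & fan_triple e x y y'].
Proof. by case=> e1 [x1 [y1 [z1 [/FDart_inj[-> -> ->] /FDart_inj[-> -> ->]]]]]. Qed.

(** For [c = true] the horizontal side [i] comes into the corner and the vertical one leaves it; for
    [c = false] the roles are exchanged. *)
Lemma square_link_corner (v : vert X) s i c (hv : corner s (if c then ordS i else i) = v)
    (hx : endpt (side s i) (c (+) start s i) = v)
    (hy : endpt (side s (spoke_side i c)) (spoke_end s i c) = v) :
  let a : square_corner v := exist _ (s, if c then ordS i else i) hv in
  let x : edge_end v := exist _ (side s i, c (+) start s i) hx in
  let y : edge_end v := exist _ (side s (spoke_side i c), spoke_end s i c) hy in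
  corner_joins a x y /\ corner_joins a y x.
Proof.
rewrite /corner_joins /=; case: c hv hx hy => /= hv hx hy.
  by rewrite ordSK; split; [right|left].
by split; [left|right].
Qed.

(* Otherwise the two corners form an embedded 2-cycle in the link of X. *)
Lemma no_bigon s i (hi : ~~ vertical (side s i)) c s' i' (hi' : ~~ vertical (side s' i')) c' :
  nonpositively_curved X ->
  PVert (corner s (if c then ordS i else i)) = p ->
  PVert (corner s' (if c' then ordS i' else i')) = p ->
  side_dart s i c = side_dart s' i' c' ->
  spoke hi c = spoke hi' c' -> spoke_end s i c = spoke_end s' i' c' ->
  in_dart hi c = in_dart hi' c'.
Proof.
move=> npc sp; rewrite -{}sp => -[hv'] [sE bE] eE cE.
set v := corner s _ in hv'; have hv : corner s (if c then ordS i else i) = v by [].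
have hx : endpt (side s i) (c (+) start s i) = v.
  by rewrite /v; case: c {hv' bE eE cE v hv}; rewrite /= ?endpt_finish ?endpt_start.
have hy : endpt (side s (spoke_side i c)) (spoke_end s i c) = v by rewrite spoke_corner.
have hx' : endpt (side s' i') (c' (+) start s' i') = v by rewrite -sE -bE.
have {}eE : side s (spoke_side i c) = side s' (spoke_side i' c') := congr1 sval eE.
have hy' : endpt (side s' (spoke_side i' c')) (spoke_end s' i' c') = v by rewrite -eE -cE.
have [j1 _] := square_link_corner hv hx hy.
have [_ j2] := square_link_corner hv' hx' hy'.
apply: contrapT => ne; apply: (npc v 2 isT).
pose x : edge_end v := exist _ (side s i, c (+) start s i) hx.
pose y : edge_end v := exist _ (side s (spoke_side i c), spoke_end s i c) hy.
pose a : square_corner v := exist _ (s, if c then ordS i else i) hv.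
pose a' : square_corner v := exist _ (s', if c' then ordS i' else i') hv'.
have {}j1 : corner_joins a x y by [].
have {}j2 : corner_joins a' y x.
  by move: j2; rewrite /corner_joins /= -!sE -!bE -!eE -!cE.
have inj2 (T : Type) (u w : T) : u <> w ->
    injective (fun k : 'I_2 => if k == ord0 then u else w).
  move=> uw [[|[|//]] ?] [[|[|//]] ?] //=; try by move=> *; apply: val_inj.
  by move/esym.
exists (fun k : 'I_2 => if k == ord0 then x else y),
  (fun k : 'I_2 => if k == ord0 then a else a'); split.
(* The two nodes differ because one edge is horizontal and the other vertical. *)
- apply: inj2 => /(congr1 (fun z => vertical (sval z).1)) /=.
  by rewrite (negPf hi) spoke_vertical.
- apply: inj2 => /(congr1 sval) [ss kk]; apply: ne; subst s'.
  (* If [c] and [c'] differed at the same corner, [i] and [i'] would be consecutive sides, so one of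
     them would be vertical. *)
  have cc : c = c'.
    case: c c' kk {sE bE eE cE hv hx hy hx' hy' j1 j2 x y a a' hv' v} => [] [] // kk.
      by move: hi'; rewrite -kk vertical_alt hi.
    by move: hi; rewrite kk vertical_alt hi'.
  subst c'; have ii : i = i'.
    by case: c kk {sE bE eE cE hv hx hy hx' hy' j1 j2 x y a a' hv' v} => //
      /(can_inj (@ordSK _)).
  by subst i'; rewrite (bool_irrelevance hi' hi).
- by case=> -[|[|//]] ?.
Qed.

Lemma in_dart_adjacent s i (hi : ~~ vertical (side s i)) c m :
  dart_adjacent (in_dart hi c) m ->
  fan_adjacent (in_dart hi c) m \/ exists s' i' c', m = side_dart s' i' c'.
Proof.
move El: (in_dart hi c) => l lm.
case: lm El => [e x y z T|s' i' hi' c' _|s' i' hi' c' _|s' i' hi' c' _] //.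
- by move=> _; left; exists e, x, y, z.
- by move=> _; right; exists s', i', c'.
Qed.

(** An edge joining two spokes at a centre lies in no triangle, since a third dart would have to
    start at two different occurrences. A triangle through a horizontal edge-end has two corners at
    a common vertical edge-end, which [no_bigon] excludes. *)
Lemma triangle_fan l0 l1 l2 :
  nonpositively_curved X ->
  dart_adjacent l0 l1 -> dart_adjacent l1 l2 -> dart_adjacent l0 l2 ->
  l0 <> l2 -> l1 <> l2 -> fan_adjacent l0 l1.
Proof.
move=> npc; case=> [e x y z T|s i hi c sp|s i hi c sp|s i hi c sp] h12 h02 n02 n12.
- by exists e, x, y, z.
- case/out_dart_adjacent: h12 => [h12|E]; last by case: n02; rewrite E negbK.
  case/out_dart_adjacent: h02 => [h02|//]; last by move=> E; case: n12.
  case: l2 h12 h02 n02 n12 => [|e b|e x y].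
  + by case=> ? [? [? [? []]]].
  + by case=> ? [? [? [? []]]].
  move=> /fan_adjacentP[_ -> _] /fan_adjacentP[_ E _]; exfalso; move: E.
  move/(congr1 (fun x : node X => if x is Occ _ j then j else i)).
  by move=> /esym/spoke_side_neq.
- case/side_dart_adjacent: h12 => s' [i' [hi' [c' [sE E sp']]]]; subst l2.
  exfalso; apply: n02; apply: (no_bigon npc) => //;
    by case/in_dart_adjacent: h02 => [/fan_adjacentP[E1 [E2] _]|[? [? [? //]]]].
case/side_dart_adjacent: h02 => s' [i' [hi' [c' [sE E sp']]]]; subst l2.
exfalso; apply: n12; apply: (no_bigon npc) => //;
  by case/in_dart_adjacent: h12 => [/fan_adjacentP[E1 [E2] _]|[? [? [? //]]]].
Qed.

(** Any two members lie in a triangle with a third one, so all adjacencies come from fans. Hence all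
    members share the edge [e] and the base node [x], and their other nodes together with [x] form a
    fan. *)
Lemma clique_link n (c : 'I_n.+3 -> dart) :
  nonpositively_curved X ->
  (forall i j, i != j -> label_adjacent lk_dart (c i) (c j)) ->
  exists u : L, forall l, label_of lk_dart u l <-> exists i, c i = l.
Proof.
move=> npc adj.
have fan i j : i != j -> fan_adjacent (c i) (c j).
  move=> ij; have [k ki kj] : exists2 k, i != k & j != k.
    have : [set~ i]%SET :\ j != finset.set0.
      rewrite -card_gt0 cardsDS; last by rewrite finset.sub1set finset.in_setC1 eq_sym.
      by rewrite cardsC1 card_ord cards1.
    case/set0Pn=> k; rewrite !finset.inE => /andP[kj ki].
    by exists k; rewrite eq_sym.
  apply: (triangle_fan (l2 := c k)) => //; try exact/label_adjacent_link/adj.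
    by case: (adj i k ki).
  by case: (adj j k kj).
pose i1 : 'I_n.+3 := lift ord0 ord0.
have [e [x [y0 [_ [c0 _ _]]]]] := fan ord0 i1 isT.
pose y i : node X := if c i is FDart _ _ y then y else Mid X.
have cE i : c i = FDart e x (y i).
  rewrite /y; have [->|i0] := eqVneq i ord0; first by rewrite c0.
  have i0C : ord0 != i by rewrite eq_sym.
  have [e' [x' [y' [z' [E -> _]]]]] := fan ord0 i i0C.
  by move: E; rewrite c0 => /FDart_inj[-> -> _].
have triple i j : i != j -> fan_triple e x (y i) (y j).
  by move/fan; rewrite !cE => /fan_adjacentP[].
pose A : {fset {classic node X}} :=
  [fset z in (x : {classic node X}) :: [seq (y i : {classic node X}) | i : 'I_n.+3]]%fset.
have memA (z : node X) : (z : {classic node X}) \in A <-> z = x \/ exists i, z = y i.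
  rewrite !inE; split.
    by case/orP=> [/eqP->|/mapP[i _ ->]]; [left|right; exists i].
  by case=> [->|[i ->]]; rewrite ?eqxx // map_f ?orbT // mem_enum.
(* Pairing each member with some other one makes the conditions on [x] and on a single [y i]
   available from triples. *)
have T i : exists j, fan_triple e x (y i) (y j).
  have [->|i0] := eqVneq i ord0; first by exists i1; apply: triple.
  by exists ord0; apply: triple.
have xA : (x : {classic node X}) \in A by apply/memA; left.
have xp : node_point e x = p by have [j []] := T ord0.
have hA : is_fan (sval e) A.
  apply/is_fan_opposite; split.
  - have yA : (y ord0 : {classic node X}) \in A by apply/memA; right; exists ord0.
    rewrite cardfE; apply/card_gt1P; exists [` xA]%fset, [` yA]%fset; split=> //.
    by apply/eqP=> /(congr1 val); have [j [_ _ []]] := T ord0.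
  - by move=> z /memA[->|[i ->]]; [have [j [_ []]] := T ord0|have [j [_ []]] := T i].
  - move=> z w /memA[->|[i ->]] /memA[->|[j ->]]; first by rewrite opposite_irr.
    + by have [k [_ _ _ []]] := T j.
    + by rewrite oppositeC; have [k [_ _ _ []]] := T i.
    + by have [->|/triple[_ _ _ []]] := eqVneq i j; rewrite ?opposite_irr.
have [u uE] := fan_link hA xA xp.
exists u => d; rewrite uE; split=> [[z [/memA zA zx ->]]|[i <-]].
  by case: zA zx => [->|[i ->]] // _; exists i.
exists (y i); split; rewrite ?cE //; first by apply/memA; right; exists i.
by have [j [_ _ [/nesym]]] := T i.
Qed.

End Link.
End Darts.

(** * Local 6-largeness of the simplexification *)

Theorem theorem2p4 (X : VH_complex) :
  nonpositively_curved X ->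
  (forall e : edge X, vertical e ->
     finite_set [set s : square X | exists i : 'I_4, side s i = e]%classic) ->
  locally_6_large (simplexification X).
Proof.
move=> npc _ v hv.
have [p {v hv}->] : exists p, v = Point p.
  case: v hv => [p|h|s i hi|e A hA]; first by exists p.
  - by rewrite /is_vertex /= card_bool.
  - by rewrite /is_vertex /= card_option card_bool.
  - by rewrite /is_vertex /= -cardfE; have [A1 _ _] := hA => E; rewrite E in A1.
have attachE := @lk_dart_attach X p; have injE := @lk_dart_inj X p.
have uniqE := @lk_dart_uniq X p.
split.
- exact: simple_labelled attachE injE uniqE.
- by apply: (flag_labelled attachE injE uniqE) => n c; apply: clique_link.
- apply: (no_short_cycle_labelled attachE injE uniqE (Z := @marked X)).
  move=> l0 l1 l2 /label_adjacent_link h01 /label_adjacent_link h12 n02 h02.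
  apply: marked_path h01 h12 n02 _ => h; apply: h02; exact/label_adjacent_link.
Qed.
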